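(* Let $d\geq 25$ be an integer and let $m=4^i$ with $i\geq 2$ be the unique power of $4$ for which $3m/2+1\leq d\leq 6m$. Then \[N(d)\geq\begin{cases} m(m/2+1) & \text{for } 3m/2+1\leq d\leq 33m/8-1;\\ 4m(d-4m+1) & \text{for } 33m/8\leq d\leq 6m-1;\\ 4m(2m+1)-1 & \text{for } d=6m. \end{cases}\]
   Context: A set of $n$ (distinct) lines through the origin in Euclidean space $\mathbb{R}^d$, represented by unit vectors $v_1,\dots,v_n$, is called equiangular if there is a constant $\alpha\geq 0$ (the common angle) such that $\langle v_i,v_j\rangle=\pm\alpha$ for all $1\leq i<j\leq n$. $N(d)$ denotes the maximum number of equiangular lines in $\mathbb{R}^d$. *)

(* Defs.v *)
From mathcomp Require Import all_boot all_order all_algebra.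
From mathcomp Require Import boolp reals.
From mathcomp Require Import zify ring lra.

Set Implicit Arguments.
Unset Strict Implicit.
Unset Printing Implicit Defensive.

Import Order.TTheory GRing.Theory Num.Theory.
Local Open Scope ring_scope.

Definition dotprod (R : realType) (d : nat) (u v : 'rV[R]_d) : R :=
  \sum_(k < d) u 0 k * v 0 k.

(* [<<v i>>%MS] is the canonical matrix of the row space of [v i], i.e. of the
   line spanned by [v i]; injectivity says that the lines are distinct. *)
Definition equiangular (R : realType) (d n : nat) (v : 'I_n -> 'rV[R]_d) : Prop :=
  [/\ forall i, dotprod (v i) (v i) = 1,
      injective (fun i => <<v i>>%MS) &
      exists2 alpha : R, 0 <= alpha &
        forall i j : 'I_n, (i < j)%N ->
          dotprod (v i) (v j) = alpha \/ dotprod (v i) (v j) = - alpha].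

Definition has_equiangular_lines (R : realType) (d n : nat) : Prop :=
  exists v : 'I_n -> 'rV[R]_d, equiangular v.

Lemma has_equiangular_lines_ex (R : realType) (d : nat) :
  exists n, `[< has_equiangular_lines R d n >].
Proof.
exists 0%N; apply/asboolP; exists (fun=> 0); split; [by case|by case|].
by exists 0 => // -[].
Qed.

Lemma dotprodC (R : realType) (d : nat) (u v : 'rV[R]_d) :
  dotprod u v = dotprod v u.
Proof. by apply: eq_bigr => k _; rewrite mulrC. Qed.

Lemma dotprod_sub (R : realType) (d : nat) (c : R) (u v : 'rV[R]_d) :
  dotprod (u - c *: v) (u - c *: v) =
  dotprod u u - 2 * c * dotprod u v + c ^+ 2 * dotprod v v.
Proof.
rewrite /dotprod !mulr_sumr -sumrB -big_split /=.
by apply: eq_bigr => k _; rewrite !mxE; ring.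
Qed.

Lemma dotprod_ge0 (R : realType) (d : nat) (u : 'rV[R]_d) : 0 <= dotprod u u.
Proof. by apply: sumr_ge0 => k _; rewrite -expr2 sqr_ge0. Qed.

Lemma dotprod_eq0 (R : realType) (d : nat) (u : 'rV[R]_d) :
  dotprod u u = 0 -> u = 0.
Proof.
move=> /eqP; rewrite psumr_eq0; last by move=> k _; rewrite -expr2 sqr_ge0.
move=> /allP h; apply/rowP => k; rewrite mxE.
by have := h k (mem_index_enum k); rewrite /= mulf_eq0 orbb => /eqP.
Qed.

(* A weak form of Gerzon's bound: the rank-one matrices [(v i)^T *m v i] are
   linearly independent. *)
Lemma has_equiangular_lines_bound (R : realType) (d n : nat) :
  `[< has_equiangular_lines R d n >] -> (n <= d * d)%N.
Proof.
move=> /asboolP [v [v1 vinj [alpha a0 va]]].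
case: (ltnP 1 n) => [n1|n1]; last first.
  case: n v v1 vinj va n1 => [//|[|//]] v v1 _ _ _.
  case: d v v1 => [|d] v v1; last by [].
  by have /eqP := v1 ord0; rewrite /dotprod big_ord0 eq_sym oner_eq0.
have sq i j : i != j -> dotprod (v i) (v j) ^+ 2 = alpha ^+ 2.
  move=> nij; have [lt|lt|/val_inj eq] := ltngtP i j.
  - by case: (va _ _ lt) => ->; rewrite ?sqrrN.
  - by rewrite dotprodC; case: (va _ _ lt) => ->; rewrite ?sqrrN.
  - by rewrite eq eqxx in nij.
have a1 : alpha ^+ 2 < 1.
  pose i0 : 'I_n := Ordinal (ltnW n1); pose i1 : 'I_n := Ordinal n1.
  have ne : i0 != i1 by [].
  have sq01 := sq _ _ ne; set c := dotprod (v i0) (v i1) in sq01.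
  have := dotprod_ge0 (v i0 - c *: v i1); rewrite dotprod_sub !v1 -/c => hge.
  rewrite -sq01 lt_neqAle; apply/andP; split; last by nra.
  apply/negP => /eqP c1; move/eqP: ne; apply; apply: vinj.
  have e0 : v i0 - c *: v i1 = 0.
    by apply: dotprod_eq0; rewrite dotprod_sub !v1 -/c; nra.
  move/eqP: e0; rewrite subr_eq0 => /eqP ->.
  apply/eq_genmx/eqmx_scale.
  by apply/eqP => c0; rewrite c0 expr0n /= in c1; lra.
pose A : 'M[R]_(n, d * d) := \matrix_i mxvec ((v i)^T *m v i).
have AE i k l : A i (mxvec_index k l) = v i 0 k * v i 0 l.
  by rewrite !mxE mxvecE !mxE big_ord1 !mxE.
have GE i j : (A *m A^T) i j = dotprod (v i) (v j) ^+ 2.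
  rewrite mxE (reindex _ (curry_mxvec_bij _ _)) /=.
  rewrite expr2 /dotprod big_distrlr /= pair_big /=.
  by apply: eq_bigr => -[k l] _ /=; rewrite [A^T _ _]mxE !AE; ring.
suff /eqP <- : row_free A by exact: rank_leq_col.
apply: inj_row_free => u uA.
have : (u *m (A *m A^T) *m u^T) 0 0 = 0 by rewrite mulmxA uA !mul0mx mxE.
have -> : A *m A^T = (1 - alpha ^+ 2)%:M + const_mx (alpha ^+ 2).
  apply/matrixP => i j; rewrite GE !mxE; have [->|/sq ->] := eqVneq i j.
    by rewrite v1 expr1n mulr1n; ring.
  by rewrite mulr0n add0r.
rewrite mulmxDr mul_mx_scalar mulmxDl -scalemxAl !mxE => h.
have e1 : \sum_j u 0 j * u^T j 0 = dotprod u u.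
  by apply: eq_bigr => j _; rewrite mxE.
have e2 : \sum_j (u *m const_mx (alpha ^+ 2)) 0 j * u^T j 0
     = alpha ^+ 2 * (\sum_j u 0 j) ^+ 2.
  rewrite expr2 mulrA mulr_sumr; apply: eq_bigr => j _.
  rewrite !mxE mulr_sumr; congr (_ * _).
  by apply: eq_bigr => k _; rewrite mxE mulrC.
rewrite e1 e2 in h.
apply: dotprod_eq0.
have p1 := dotprod_ge0 u.
have p2 : 0 <= alpha ^+ 2 * (\sum_j u 0 j) ^+ 2 by rewrite mulr_ge0 ?sqr_ge0.
by nra.
Qed.

Definition max_equiangular (R : realType) (d : nat) : nat :=
  ex_maxn (has_equiangular_lines_ex R d) (@has_equiangular_lines_bound R d).

(* The division is exact for even [m]; of the powers of 4 only [m = 1] is odd,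
   and for it the upper bound is [d <= 6]. *)
Definition in_window (d m : nat) : Prop :=
  (3 * m %/ 2 + 1 <= d <= 6 * m)%N.

(* Main.v *)
Require Import Defs.
From HB Require Import structures.
From mathcomp Require Import all_boot all_order all_algebra all_field.
From mathcomp Require Import boolp reals.
From mathcomp Require Import zify ring lra.

(** Let [X] be an elementary abelian 2-group of order [4 ^ t].  A Kerdock set
    gives [4 ^ t / 2] orthogonal bases of the functions on [X], all made of
    functions with values in {1, -1}; together with the standard basis, rescaled
    by [q = 2 ^ t], they are mutually unbiased: vectors of different bases
    have inner product [q] or [- q], while those of one basis have norm
    [q ^ 2] and inner product 0.  Give each basis one more coordinate of its own,
    equal to [sqrt q] on the vectors of that basis and to 0 on the others.  Two
    vectors of the same basis now also have inner product [q], so that all the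
    vectors span equiangular lines ([kerdock_line_angle]).  With [k] bases
    this takes [4 ^ t + k] coordinates and gives [4 ^ t * k] lines.

    A coordinate can be spared.  The functions of the Kerdock bases are all 1
    at [0 : X], so their extensions are orthogonal to the vector [w] that is 1
    at [0 : X] and [- 1 / sqrt q] at the coordinates of these bases; so are the
    extended standard basis vectors, except the one supported at 0.  The lines
    then live in the hyperplane orthogonal to [w], and a reflection brings it
    into a coordinate hyperplane ([kerdock_lines_hyperplane]).

    The bound for small [d] uses all bases for [X] of order [m]; the other two
    take [X] of order [4 * m] and spare one coordinate, either with
    [k = d - 4 * m + 1] Kerdock bases, or with all bases, dropping one line.

    The Kerdock bases come from quadratic forms on [X = F * Z/2], where [F] is
    a field with [2 ^ n] elements, [n] odd.  To [s : F] is attached a form [Q_s]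
    whose polarization is
      [Tr(sx) Tr(sy) + Tr(s^2 xy) + e Tr(sy) + f Tr(sx)]
    at [(x, e)] and [(y, f)].  The sum of two of these polarizations is
    nondegenerate ([kerdock_form_nondeg]); hence [(-1) ^ (Q_s + Q_s' + linear)]
    is a bent function, whose sum over [X] has square [#|X|] ([sum_bent_sqr]). *)

Set Implicit Arguments.
Unset Strict Implicit.
Unset Printing Implicit Defensive.

Import Order.TTheory GRing.Theory Num.Theory.

Local Open Scope ring_scope.

(** * Sums of signs over a finite abelian group *)

HB.instance Definition _ (U V : finZmodType) := GRing.Zmodule.on (U * V)%type.

Section SignSums.
Variables (R : realDomainType) (X : finZmodType).

Lemma sum_sign_character (g : X -> R) (x0 : X) :
    (forall x y, g (x + y) = g x * g y) -> g x0 = -1 ->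
  \sum_x g x = 0.
Proof.
move=> gD gx0; have : \sum_x g x = - \sum_x g x.
  rewrite {1}(reindex_inj (addrI x0)) -sumrN; apply: eq_bigr => x _ /=.
  by rewrite gD gx0 mulN1r.
by lra.
Qed.

(** [B] is the sign of the polarization of the quadratic function whose sign is
    [g].  Writing the second index of the square of the sum as [x + y] leaves
    [g y] times the sum of the character [B ^~ y], which vanishes for
    nonzero [y]. *)
Lemma sum_bent_sqr (g : X -> R) (B : X -> X -> R) :
    (forall x, g x * g x = 1) ->
    (forall x y, g (x + y) = g x * g y * B x y) ->
    (forall x x' y, B (x + x') y = B x y * B x' y) ->
    (forall y, y != 0 -> exists x, B x y = -1) ->
  (\sum_x g x) ^+ 2 = #|X|%:R.
Proof.
move=> g2 gD BD Bnd.
have g0 : g 0 = 1.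
  have := gD 0 0; have := BD 0 0 0; rewrite !addr0 g2 mul1r => B0 g0.
  by rewrite g0 B0 -g0 g2.
have BX0 x : B x 0 = 1.
  have := gD x 0; rewrite addr0 g0 mulr1 => /(congr1 ( *%R (g x))).
  by rewrite mulrA g2 mul1r.
transitivity (\sum_y g y * \sum_x B x y).
  rewrite expr2 big_distrlr /=.
  under eq_bigr => x _ do rewrite (reindex_inj (addrI x)) /=.
  rewrite exchange_big /=; apply: eq_bigr => y _.
  rewrite mulr_sumr; apply: eq_bigr => x _.
  by rewrite gD !mulrA g2 mul1r.
rewrite (bigD1 0) //= [X in _ + X]big1 ?addr0; last first.
  move=> y y0; have [x Bxy] := Bnd y y0.
  by rewrite (@sum_sign_character (B^~ y) x) ?mulr0.
by rewrite g0 mul1r (eq_bigr (fun=> 1)) // sumr_const.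
Qed.

End SignSums.

(** * The Kerdock set of quadratic forms *)

Section Kerdock.
Variables (F : finFieldType) (h : nat).
Hypotheses (F2 : 2 \in [pchar F]) (cardF : #|F| = (2 ^ h.*2.+1)%N).

Let two0 : 2%:R = 0 :> F. Proof. exact: pcharf0 F2. Qed.

Let addr_eq0_pchar2 (x y : F) : x + y = 0 -> x = y.
Proof. by move/eqP; rewrite addr_eq0 oppr_pchar2 // => /eqP. Qed.

Lemma exprD_pchar2 (x y : F) (k : nat) :
  (x + y) ^+ (2 ^ k) = x ^+ (2 ^ k) + y ^+ (2 ^ k).
Proof.
apply: exprDn_pchar; apply/pnatP=> [|p pp]; first by rewrite expn_gt0.
by rewrite Euclid_dvdX // dvdn_prime2 // => /andP[/eqP-> _].
Qed.

(** The absolute trace, with values in the prime field seen inside [F]; being in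
    the prime field is expressed as being idempotent. *)
Definition trace (x : F) : F := \sum_(i < h.*2.+1) x ^+ (2 ^ i).

Lemma traceD x y : trace (x + y) = trace x + trace y.
Proof. by rewrite -big_split; apply: eq_bigr => i _; exact: exprD_pchar2. Qed.

Lemma trace0 : trace 0 = 0.
Proof. by apply: (addrI (trace 0)); rewrite -traceD !addr0. Qed.

(** The degree of [F] over its prime field is odd. *)
Lemma trace1 : trace 1 = 1.
Proof.
rewrite /trace (eq_bigr (fun=> 1)) => [|i _]; last by rewrite expr1n.
rewrite sumr_const card_ord -addn1 -muln2 mulrnDr mulrnA -mulr_natr two0.
by rewrite mulr0 add0r.
Qed.

Lemma expr_card2 (x : F) : x ^+ (2 ^ h.*2.+1) = x.
Proof. by rewrite -cardF expf_card. Qed.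

Lemma trace_sqr x : trace (x ^+ 2) = trace x.
Proof.
rewrite /trace big_ord_recr big_ord_recl /= addrC -exprM -expnS expr_card2.
by congr (_ + _); apply: eq_bigr => i _; rewrite -exprM -expnS.
Qed.

Lemma sqr_trace x : trace x ^+ 2 = trace x.
Proof.
rewrite -[RHS]trace_sqr /trace; elim/big_rec2: _ => [|i y z _ IH].
  by rewrite expr0n.
by rewrite -[2%N]/(2 ^ 1)%N exprD_pchar2 IH expn1 -!exprM mulnC.
Qed.

Lemma trace_frob x k : trace (x ^+ (2 ^ k)) = trace x.
Proof.
by elim: k => [|k IH]; rewrite ?expr1 // expnSr exprM trace_sqr IH.
Qed.

Lemma idempotentP (z : F) : z ^+ 2 = z -> {z = 0} + {z = 1}.
Proof.
have [->|z0] := eqVneq z 0; [by left|move=> z2; right].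
by apply: (mulfI z0); rewrite mulr1 -expr2.
Qed.

Lemma idempotentD (z z' : F) :
  z ^+ 2 = z -> z' ^+ 2 = z' -> (z + z') ^+ 2 = z + z'.
Proof. by move=> zz zz'; rewrite (exprD_pchar2 z z' 1) zz zz'. Qed.

Lemma idempotentM (z z' : F) :
  z ^+ 2 = z -> z' ^+ 2 = z' -> (z * z') ^+ 2 = z * z'.
Proof. by move=> zz zz'; rewrite exprMn zz zz'. Qed.

Lemma trace_scale z x : z ^+ 2 = z -> trace (z * x) = z * trace x.
Proof. by case/idempotentP=> ->; rewrite ?mul0r ?trace0 ?mul1r. Qed.

Lemma trace_nondeg x : (forall y, trace (y * x) = 0) -> x = 0.
Proof.
move=> tx; apply: contraTeq (oner_neq0 F) => x0.
by rewrite -trace1 -(mulVf x0) tx eqxx.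
Qed.

Definition kerdock_quad (u : F) : F :=
  \sum_(i < h) trace (u ^+ (2 ^ i.+1).+1).

Lemma sqr_kerdock_quad u : kerdock_quad u ^+ 2 = kerdock_quad u.
Proof.
rewrite /kerdock_quad; elim/big_rec: _ => [|i z _ IH]; first by rewrite expr0n.
by rewrite -[2%N]/(2 ^ 1)%N exprD_pchar2 expn1 IH sqr_trace.
Qed.

(** The cross terms of index [j] are [Tr(u^(2^j) v)] and [Tr(u v^(2^j))], and
    the latter is [Tr(u^(2^(n-j)) v)] for [n] the degree of [F].  As [j] runs
    through 1, ..., h with [n = 2h + 1], the exponents [j] and [n - j] run
    through 1, ..., n - 1: the cross terms add up to [Tr((Tr(u) + u) v)]. *)
Lemma kerdock_quadD u v :
  kerdock_quad (u + v) =
    kerdock_quad u + kerdock_quad v + trace u * trace v + trace (u * v).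
Proof.
have cross (i : 'I_h) : trace ((u + v) ^+ (2 ^ i.+1).+1) =
    trace (u ^+ (2 ^ i.+1).+1) + trace (v ^+ (2 ^ i.+1).+1)
  + (trace (u ^+ (2 ^ i.+1) * v) + trace (u ^+ (2 ^ (h.*2 - i)) * v)).
  have -> : trace (u ^+ (2 ^ (h.*2 - i)) * v) = trace (u * v ^+ (2 ^ i.+1)).
    rewrite -(trace_frob _ i.+1) exprMn -exprM -expnD.
    have -> : (h.*2 - i + i.+1 = h.*2.+1)%N by have := ltn_ord i; lia.
    by rewrite expr_card2.
  by rewrite !exprS exprD_pchar2 -!traceD; congr trace; ring.
rewrite /kerdock_quad (eq_bigr _ (fun i _ => cross i)) !big_split /= -!addrA.
congr (_ + (_ + _)).
rewrite -[in RHS](trace_scale _ (sqr_trace u)) -traceD -mulrDl.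
have -> : trace u + u = \sum_(1 <= i < h.*2.+1) u ^+ (2 ^ i).
  rewrite /trace -(big_mkord predT (fun i => u ^+ (2 ^ i))) big_ltn //.
  by rewrite expr1 addrAC addrr_pchar2 // add0r.
have traces (I : finType) (f : I -> F) : trace (\sum_i f i) = \sum_i trace (f i).
  exact: (big_morph _ traceD trace0).
have -> : \sum_(1 <= i < h.*2.+1) u ^+ (2 ^ i) =
   \sum_(i < h) u ^+ (2 ^ i.+1) + \sum_(i < h) u ^+ (2 ^ (h.*2 - i)).
  rewrite (@big_cat_nat _ _ _ h.+1) ?ltnS -?addnn ?leq_addr //=; congr (_ + _).
    by rewrite big_add1 big_mkord.
  rewrite -addSn addnC -{1}[h.+1]addn0 addnC big_addn.
  have -> : (h + h.+1 - h.+1 = h)%N by lia.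
  rewrite big_mkord (reindex_inj rev_ord_inj) /=.
  by apply: eq_bigr => i _; congr (_ ^+ (2 ^ _)); have := ltn_ord i; lia.
by rewrite mulrDl traceD !mulr_suml !traces.
Qed.

Definition bit (e : 'I_2) : F := (e : nat)%:R.

Lemma bitD e e' : bit (e + e') = bit e + bit e'.
Proof.
have t0 := two0; rewrite /bit.
by case: e e' => -[|[|//]] ? [[|[|//]] ?] /=;
  rewrite ?addr0 ?add0r // -mulr2n.
Qed.

Lemma sqr_bit e : bit e ^+ 2 = bit e.
Proof.
by rewrite /bit; case: e => -[|[|//]] ? /=; rewrite ?expr0n ?expr1n.
Qed.

Local Notation X := (F * 'I_2)%type.

(** The polarization of [kerdock_fun s a], which does not depend on the linear
    part [a]. *)
Definition kerdock_form (s : F) (x y : X) : F :=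
  trace (s * x.1) * trace (s * y.1) + trace (s * x.1 * (s * y.1))
  + bit x.2 * trace (s * y.1) + bit y.2 * trace (s * x.1).

Definition kerdock_fun (s : F) (a x : X) : F :=
  kerdock_quad (s * x.1) + bit x.2 * trace (s * x.1)
  + (trace (a.1 * x.1) + bit a.2 * bit x.2).

Lemma sqr_kerdock_form s x y : kerdock_form s x y ^+ 2 = kerdock_form s x y.
Proof.
by rewrite /kerdock_form !(idempotentD, idempotentM) ?(sqr_trace, sqr_bit).
Qed.

Lemma sqr_kerdock_fun s a x : kerdock_fun s a x ^+ 2 = kerdock_fun s a x.
Proof.
by rewrite /kerdock_fun !(idempotentD, idempotentM)
  ?(sqr_trace, sqr_bit, sqr_kerdock_quad).
Qed.

Lemma kerdock_formDl s x x' y :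
  kerdock_form s (x + x') y = kerdock_form s x y + kerdock_form s x' y.
Proof. by rewrite /kerdock_form /= bitD !(mulrDr, mulrDl) !traceD; ring. Qed.

Lemma kerdock_funD s a x y :
  kerdock_fun s a (x + y) =
    kerdock_fun s a x + kerdock_fun s a y + kerdock_form s x y.
Proof.
rewrite /kerdock_fun /kerdock_form /= bitD !mulrDr kerdock_quadD !traceD.
ring.
Qed.

Lemma kerdock_fun0 s a : kerdock_fun s a 0 = 0.
Proof.
have b0 : bit 0 = 0 by [].
apply: (addrI (kerdock_fun s a 0)); rewrite addr0.
have := kerdock_funD s a 0 0; rewrite addr0 => {3}->.
by rewrite /kerdock_form /= !mulr0 trace0 b0 mul0r !addr0.
Qed.

(** Let [(y, e)] be in the radical of the sum of the two forms.  Testing it on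
    [(0, 1)] shows that [s y] and [s' y] have the same trace [tau]; testing it on
    all [(x, 0)] shows, as the trace form is nondegenerate, that
    [(s + s') y = tau + e].  Here the left-hand side has trace 0 and, the
    degree of [F] being odd, the right-hand side is its own trace.  Hence
    [y = 0], then [tau = 0] and [e = 0]. *)
Lemma kerdock_form_nondeg s s' y : s != s' -> y != 0 ->
  exists x, kerdock_form s x y + kerdock_form s' x y = 1.
Proof.
case: y => y e ss' y0.
apply/not_existsP => noX; move/negP: y0; apply; apply/eqP.
have form0 x : kerdock_form s x (y, e) + kerdock_form s' x (y, e) = 0.
  by have /idempotentP[|/noX] := idempotentD
    (sqr_kerdock_form s x (y, e)) (sqr_kerdock_form s' x (y, e)).
have tauE : trace (s * y) = trace (s' * y).
  have := form0 (0, 1); rewrite /kerdock_form /= !mulr0 !mul0r trace0 /bit /=.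
  by rewrite !mul0r !mulr0 !mul1r !add0r !addr0 => /addr_eq0_pchar2.
set tau := trace (s * y) in tauE.
have tb2 : (tau + bit e) ^+ 2 = tau + bit e.
  by rewrite idempotentD ?sqr_trace ?sqr_bit.
have prod0 : (s + s') * ((tau + bit e) + (s + s') * y) = 0.
  apply: trace_nondeg => x.
  rewrite -[RHS](form0 (x, 0)) /kerdock_form /= -/tau -tauE /bit /=.
  rewrite !mul0r !addr0 -/(bit e) ![trace _ * tau]mulrC.
  have -> : x * ((s + s') * (tau + bit e + (s + s') * y)) =
     (tau + bit e) * (s * x) + (tau + bit e) * (s' * x) +
     (s * x * (s * y) + s' * x * (s' * y)) + 2%:R * (s * s' * x * y).
    by ring.
  by rewrite two0 mul0r addr0 !traceD !(trace_scale _ tb2); ring.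
have ss'0 : s + s' != 0 by apply: contra ss' => /eqP/addr_eq0_pchar2->.
have {prod0}yE : (s + s') * y = tau + bit e.
  by move/eqP: prod0; rewrite mulf_eq0 (negPf ss'0) => /eqP/addr_eq0_pchar2.
have tb0 : tau + bit e = 0.
  have := congr1 trace yE.
  rewrite mulrDl [LHS]traceD -/tau -tauE addrr_pchar2 //.
  by rewrite -[tau + _]mulr1 (trace_scale _ tb2) trace1 mulr1.
have y1 : y = 0.
  by move/eqP: yE; rewrite tb0 mulf_eq0 (negPf ss'0) => /eqP.
move: tb0; rewrite /tau {1}y1 mulr0 trace0 add0r.
case: e {form0 noX yE tauE tb2} => -[|[|//]] e /= b0.
  by congr pair; [exact: y1 | exact: val_inj].
by move/eqP: b0; rewrite /bit oner_eq0.
Qed.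

(** * The Kerdock bases *)

Variable R : realDomainType.

Definition sgn2 (z : F) : R := (-1) ^+ (z != 0).

Lemma sgn2D (z z' : F) : z ^+ 2 = z -> z' ^+ 2 = z' ->
  sgn2 (z + z') = sgn2 z * sgn2 z'.
Proof.
rewrite /sgn2 => /idempotentP[]-> /idempotentP[]->;
  rewrite ?addr0 ?add0r ?(addrr_pchar2 F2) ?eqxx ?oner_eq0 /=;
  by rewrite ?mulr1 ?mul1r ?mulrNN ?mulr1.
Qed.

Lemma sgn2_sqr z : sgn2 z * sgn2 z = 1.
Proof. by rewrite /sgn2 -expr2 sqrr_sign. Qed.

Definition kerdock_vec s a x : R := sgn2 (kerdock_fun s a x).

Lemma kerdock_vec0 s a : kerdock_vec s a 0 = 1.
Proof. by rewrite /kerdock_vec kerdock_fun0 /sgn2 eqxx. Qed.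

Lemma kerdock_vecD s a x y : kerdock_vec s a (x + y) =
  kerdock_vec s a x * kerdock_vec s a y * sgn2 (kerdock_form s x y).
Proof.
rewrite /kerdock_vec kerdock_funD sgn2D ?sqr_kerdock_form //.
  by congr (_ * _); rewrite sgn2D ?sqr_kerdock_fun.
by rewrite idempotentD ?sqr_kerdock_fun.
Qed.

(** The quadratic parts cancel, leaving the sum of a character; it is not
    trivial since two different linear parts differ somewhere. *)
Lemma kerdock_orthogonal s a a' : a != a' ->
  \sum_x kerdock_vec s a x * kerdock_vec s a' x = 0.
Proof.
move=> aa'.
have [x0 x0P] : exists x : X, kerdock_fun s a x + kerdock_fun s a' x = 1.
  have dE x : kerdock_fun s a x + kerdock_fun s a' x =
      trace ((a.1 + a'.1) * x.1) + (bit a.2 + bit a'.2) * bit x.2.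
    rewrite mulrDl traceD /kerdock_fun.
    have := two0; set q := _ + _ * trace _ => t0.
    transitivity (2%:R * q + (trace (a.1 * x.1) + trace (a'.1 * x.1)
      + (bit a.2 + bit a'.2) * bit x.2)); first by ring.
    by rewrite t0 mul0r add0r.
  have [a1|a1] := eqVneq (a.1 + a'.1) 0.
    exists (0, 1); rewrite dE /= mulr0 trace0 add0r /bit /= mulr1.
    have a1E := addr_eq0_pchar2 a1.
    move: aa'; case: a a' a1E {a1 dE} => [a e] [a' e'] /= ->.
    rewrite xpair_eqE eqxx /=.
    by case: e e' => -[|[|//]] ? [[|[|//]] ?] //=; rewrite ?addr0 ?add0r.
  exists ((a.1 + a'.1)^-1, 0).
  by rewrite dE /= mulfV // trace1 /bit /= mulr0 addr0.
apply: (@sum_sign_character R X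
  (fun x => kerdock_vec s a x * kerdock_vec s a' x) x0) => [x y|].
  rewrite !kerdock_vecD; have := sgn2_sqr (kerdock_form s x y).
  by set w := sgn2 _ => w2; rewrite -[RHS]mulr1 -w2; ring.
by rewrite -sgn2D ?sqr_kerdock_fun // x0P /sgn2 oner_eq0.
Qed.

Lemma kerdock_unbiased s s' a a' : s != s' ->
  (\sum_x kerdock_vec s a x * kerdock_vec s' a' x) ^+ 2 = #|{: X}|%:R.
Proof.
move=> ss'.
apply: (@sum_bent_sqr _ _ _
  (fun x y => sgn2 (kerdock_form s x y + kerdock_form s' x y))).
- by move=> x; rewrite mulrACA !sgn2_sqr mulr1.
- move=> x y; rewrite !kerdock_vecD sgn2D ?sqr_kerdock_form //.
  by ring.
- move=> x x' y; rewrite !kerdock_formDl -sgn2D.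
  + by congr sgn2; ring.
  + by rewrite idempotentD ?sqr_kerdock_form.
  + by rewrite idempotentD ?sqr_kerdock_form.
- move=> y y0; have [x xP] := kerdock_form_nondeg ss' y0.
  by exists x; rewrite xP /sgn2 oner_eq0.
Qed.

End Kerdock.

(** * Equiangular lines from vectors indexed by a finite type *)

Section Geometry.
Variables (R : realType) (I : finType).
Implicit Types x y w : I -> R.

Definition dotp x y : R := \sum_i x i * y i.

(** The Householder reflection that maps [w] to the negative of its norm times
    the basis vector at [i0], written in the form that it takes on the
    hyperplane orthogonal to [w]. *)
Definition reflect_out (i0 : I) w x : I -> R :=
  let n := Num.sqrt (dotp w w) in
  fun i => x i - x i0 / (n + w i0) * (w i + n *+ (i == i0)).

Lemma sum_delta (i0 : I) y : \sum_i y i *+ (i == i0) = y i0.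
Proof. by rewrite (bigD1 i0) //= eqxx big1 ?addr0 // => i /negPf->. Qed.

Lemma dotp_reflect_out i0 w x y :
    0 < w i0 -> dotp w x = 0 -> dotp w y = 0 ->
  dotp (reflect_out i0 w x) (reflect_out i0 w y) = dotp x y.
Proof.
move=> w0 wx wy; rewrite {1}/dotp /reflect_out.
set n := Num.sqrt _.
have n2 : n ^+ 2 = dotp w w.
  by rewrite sqr_sqrtr // sumr_ge0 // => i _; rewrite -expr2 sqr_ge0.
have n0 : 0 <= n by exact: sqrtr_ge0.
set p := x i0 / _; set q := y i0 / _.
have xp : x i0 = p * (n + w i0) by rewrite /p divfK // gt_eqF // ltr_wpDl.
have yq : y i0 = q * (n + w i0) by rewrite /q divfK // gt_eqF // ltr_wpDl.
clearbody p q.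
transitivity (dotp x y - q * (dotp w x + n * \sum_i x i *+ (i == i0))
   - p * (dotp w y + n * \sum_i y i *+ (i == i0))
   + p * q * (dotp w w + 2%:R * n * \sum_i w i *+ (i == i0)
       + n ^+ 2 * \sum_i 1 *+ (i == i0))).
  rewrite /dotp !mulr_sumr -!big_split /= !mulr_sumr -!sumrB -big_split /=.
  by apply: eq_bigr => i _; case: (i == i0); rewrite ?mulr1n ?mulr0n; ring.
by rewrite !sum_delta wx wy xp yq -n2; ring.
Qed.

Lemma reflect_out0 i0 w x : 0 < w i0 -> reflect_out i0 w x i0 = 0.
Proof.
move=> w0; rewrite /reflect_out eqxx mulr1n [w i0 + _]addrC divfK ?subrr //.
by rewrite gt_eqF // ltr_wpDl ?sqrtr_ge0.
Qed.

Lemma reflect_out_supp (C : {set I}) i0 w x : 0 < w i0 ->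
    (forall i, i \notin C -> w i = 0) -> (forall i, i \notin C -> x i = 0) ->
  forall i, i \notin C :\ i0 -> reflect_out i0 w x i = 0.
Proof.
move=> w0 wC xC i; rewrite !inE negb_and negbK.
have [->|ii0 /= iC] := eqVneq i i0; first by rewrite reflect_out0.
by rewrite /reflect_out (negPf ii0) (wC i) // (xC i) // addr0 mulr0 subr0.
Qed.

(** Vectors supported in [C] are vectors of dimension [#|C|], padded with zeros
    up to dimension [d] and normalized.  The lines are distinct because two
    unit vectors of the same line have inner product 1 or -1, and [a < N]. *)
Lemma equiangular_embedding (T : finType) (L : {set T}) (C : {set I})
    (x : T -> I -> R) (N a : R) (d : nat) :
    0 <= a < N ->
    {in L, forall l i, i \notin C -> x l i = 0} ->
    {in L, forall l, dotp (x l) (x l) = N} ->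
    {in L &, forall l l', l != l' ->
       dotp (x l) (x l') = a \/ dotp (x l) (x l') = - a} ->
    (#|C| <= d)%N ->
  (#|L| <= max_equiangular R d)%N.
Proof.
move=> /andP[a0 aN] xC xN xa Cd.
have N0 : 0 < N by apply: le_lt_trans aN.
suff exL : has_equiangular_lines R d #|L|.
  by rewrite /max_equiangular; case: ex_maxnP => n _; apply; exact/asboolP.
pose r := (Num.sqrt N)^-1.
have r2 : r * r = N^-1 by rewrite -expr2 exprVn sqr_sqrtr // ltW.
pose v (l : 'I_#|L|) : 'rV[R]_d :=
  \row_k (if insub (val k) is Some j
          then r * x (enum_val l) (enum_val (j : 'I_#|C|)) else 0).
have Lin (l : 'I_#|L|) : enum_val l \in L by exact: enum_valP.
have vE l l' :
    dotprod (v l) (v l') = dotp (x (enum_val l)) (x (enum_val l')) / N.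
  rewrite -r2 /dotprod /dotp mulr_suml.
  rewrite (bigID (mem C)) /= [X in _ = _ + X]big1; last first.
    by move=> i iC; rewrite xC // !mul0r.
  rewrite addr0 [RHS]big_enum_val /=.
  rewrite (bigID (fun k : 'I_d => (k < #|C|)%N)) /=.
  rewrite [X in _ + X]big1 ?addr0; last first.
    by move=> k kC; rewrite !mxE insubN // mul0r.
  rewrite (big_ord_narrow Cd); apply: eq_bigr => j _; rewrite !mxE /=.
  by rewrite valK; ring.
have v1 l : dotprod (v l) (v l) = 1 by rewrite vE xN // divff // gt_eqF.
have va l l' : l != l' ->
    dotprod (v l) (v l') = a / N \/ dotprod (v l) (v l') = - (a / N).
  move=> ll'; rewrite vE -mulNr.
  have := xa _ _ (Lin l) (Lin l'); rewrite (inj_eq enum_val_inj) => /(_ ll').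
  by case=> ->; [left | right].
exists v; split => //; last first.
  exists (a / N) => [|l l' ll']; first by rewrite divr_ge0 // ltW.
  by apply: va; rewrite -val_eqE /= ltn_eqF.
have b1 : a / N < 1 by rewrite ltr_pdivrMr // mul1r.
have b0 : 0 <= a / N by rewrite divr_ge0 // ltW.
move=> l l' /= /genmxP/eqmxP vv; apply/eqP/negPn/negP => ll'.
have /sub_rVP[c vc] : (v l <= v l')%MS by rewrite vv.
have c2 : c ^+ 2 = 1.
  rewrite -(v1 l) vc /dotprod -[LHS]mulr1 -(v1 l') mulr_sumr.
  by apply: eq_bigr => k _; rewrite !mxE; ring.
have cE : dotprod (v l) (v l') = c.
  rewrite vc /dotprod -[RHS]mulr1 -(v1 l') mulr_sumr.
  by apply: eq_bigr => k _; rewrite !mxE; ring.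
have := va _ _ ll'; rewrite cE; set b := a / N in b0 b1 *.
by case=> cb; rewrite cb in c2; nra.
Qed.

End Geometry.

(** * Lines from the Kerdock bases *)

Section KerdockLines.
Variables (R : realType) (F : finFieldType) (h : nat).
Hypotheses (F2 : 2 \in [pchar F]) (cardF : #|F| = (2 ^ h.*2.+1)%N).

Local Notation X := (F * 'I_2)%type.
Local Notation line := (option F * X)%type.
Local Notation coordinate := (X + option F)%type.

Let q : R := (2 ^ h.+1)%:R.

Let q_gt0 : 0 < q. Proof. by rewrite ltr0n expn_gt0. Qed.

Let cardX : #|{: X}|%:R = q ^+ 2.
Proof.
rewrite card_prod card_ord cardF -natrX; congr _%:R.
by rewrite -expnSr -expnM; congr (_ ^ _)%N; lia.
Qed.

Let sqrt_q : Num.sqrt q * Num.sqrt q = q.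
Proof. by rewrite -expr2 sqr_sqrtr // ltW. Qed.

(** The first component of a line is its basis: the one attached to [s] for
    [Some s], the standard basis for [None].  The coordinates [inr j] are the
    additional ones, one for each basis. *)
Definition kerdock_line (l : line) (i : coordinate) : R :=
  match i, l.1 with
  | inl x, Some s => kerdock_vec h R s l.2 x
  | inl x, None => q *+ (x == l.2)
  | inr j, b => Num.sqrt q *+ (j == b)
  end.

Lemma dotp_kerdock_line l l' : dotp (kerdock_line l) (kerdock_line l') =
  \sum_x kerdock_line l (inl x) * kerdock_line l' (inl x)
  + q *+ (l.1 == l'.1).
Proof.
rewrite /dotp big_sumType /=; congr (_ + _).
rewrite (bigD1 l.1) //= eqxx big1 ?addr0 => [|j /negPf->].
  by rewrite mulr1n; case: eqP => _; rewrite ?mulr1n ?mulr0n ?mulr0 ?sqrt_q.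
by rewrite mul0r.
Qed.

Lemma kerdock_line_norm l :
  dotp (kerdock_line l) (kerdock_line l) = q ^+ 2 + q.
Proof.
rewrite dotp_kerdock_line eqxx mulr1n; congr (_ + _).
case: l => -[s|] a /=.
  rewrite (eq_bigr (fun=> 1)) => [|x _]; last exact: sgn2_sqr.
  by rewrite sumr_const cardX.
rewrite (bigD1 a) //= eqxx big1 ?addr0 => [|x /negPf->]; last by rewrite mul0r.
by rewrite mulr1n expr2.
Qed.

Lemma kerdock_line_angle l l' : l != l' ->
  dotp (kerdock_line l) (kerdock_line l') = q \/
  dotp (kerdock_line l) (kerdock_line l') = - q.
Proof.
have sgnq (z : F) : q * sgn2 R z = q \/ q * sgn2 R z = - q.
  rewrite /sgn2; case: (z != 0); last by left; rewrite mulr1.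
  by right; rewrite mulrN1.
rewrite dotp_kerdock_line.
case: l l' => -[s|] a [[s'|] a'] /= ll'; rewrite ?mulr0n ?addr0.
- have [ss|ss'] := eqVneq s s'.
    move: ll'; rewrite -ss xpair_eqE eqxx /= => aa'.
    by rewrite (kerdock_orthogonal F2 cardF) // ?eqxx add0r; left.
  rewrite (_ : (Some s == Some s') = false) ?addr0; last exact/negbTE.
  have /eqP := kerdock_unbiased F2 cardF R a a' ss'.
  by rewrite cardX eqf_sqr => /orP[]/eqP; [left | right].
- rewrite (bigD1 a') //= eqxx big1 ?addr0 => [|x /negPf->].
    by rewrite mulr1n mulrC; exact: sgnq.
  by rewrite mulr0.
- rewrite (bigD1 a) //= eqxx big1 ?addr0 => [|x /negPf->].
    by rewrite mulr1n; exact: sgnq.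
  by rewrite mul0r.
- rewrite big1 ?add0r ?eqxx; first by left.
  move=> x _; have [xa|] := eqVneq x a; last by rewrite mul0r.
  case: eqVneq => [xa'|]; last by rewrite mulr0.
  by move: ll'; rewrite -xa -xa' eqxx.
Qed.

Lemma kerdock_lines_all d : (#|{: X}| + #|F|.+1 <= d)%N ->
  (#|{: X}| * #|F|.+1 <= max_equiangular R d)%N.
Proof.
move=> le_d; rewrite mulnC -[in X in (X <= _)%N]card_option -card_prod -cardsT.
apply: (@equiangular_embedding R coordinate _ _ setT kerdock_line (q ^+ 2 + q) q).
- by rewrite ltW // ltrDr exprn_gt0.
- by move=> l _ i; rewrite inE.
- by move=> l _; exact: kerdock_line_norm.
- by move=> l l' _ _; exact: kerdock_line_angle.
- by rewrite cardsT card_sum card_option.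
Qed.

(** All the lines of [L] are orthogonal to one vector [w] supported in [C].
    [S] indexes the Kerdock bases among the bases that [L] meets; on the
    standard basis [w] has no additional coordinate to cancel its value at 0,
    whence the condition on [l.2]. *)
Lemma kerdock_lines_hyperplane (S : {set F}) (L : {set line})
    (C : {set coordinate}) (d : nat) :
    (forall l, l \in L -> if l.1 is Some s then s \in S else l.2 != 0) ->
    (forall x, inl x \in C) -> (forall s, s \in S -> inr (Some s) \in C) ->
    (forall l, l \in L -> inr l.1 \in C) ->
    (#|C| <= d.+1)%N ->
  (#|L| <= max_equiangular R d)%N.
Proof.
move=> LS CX CS CL Cd.
pose w (i : coordinate) : R := match i with
  | inl x => (x == 0)%:R
  | inr (Some s) => - (Num.sqrt q)^-1 *+ (s \in S)
  | inr None => 0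
  end.
have w0 : 0 < w (inl 0) by rewrite /w eqxx ltr01.
have wC i : i \notin C -> w i = 0.
  case: i => [x|[s|]] //=; first by rewrite CX.
  by case: (boolP (s \in S)) => // /CS->.
have lC l : l \in L -> forall i, i \notin C -> kerdock_line l i = 0.
  move=> /CL lC [x|j] /=; first by rewrite CX.
  by case: eqP => // ->; rewrite lC.
have wl l : l \in L -> dotp w (kerdock_line l) = 0.
  move=> lL; rewrite /dotp big_sumType /= (bigD1 0) //= eqxx mul1r.
  rewrite [X in _ + X + _]big1 ?addr0 => [|x /negPf->]; last by rewrite mul0r.
  rewrite (bigD1 l.1) //= eqxx mulr1n.
  rewrite big1 ?addr0 => [|j /negPf->]; last by rewrite mulr0.
  have := LS l lL; case: l {lL} => -[s|] a /=.
    move=> ->; rewrite (kerdock_vec0 F2 cardF) mulr1n mulNr mulVf ?subrr //.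
    by rewrite gt_eqF ?sqrtr_gt0.
  by move/negPf=> a0; rewrite [0 == a]eq_sym a0 mul0r addr0.
apply: (@equiangular_embedding R coordinate _ L (C :\ inl 0)
  (fun l => @reflect_out R coordinate (inl 0) w (kerdock_line l))
  (q ^+ 2 + q) q).
- by rewrite ltW // ltrDr exprn_gt0.
- by move=> l lL i; apply: reflect_out_supp => //; exact: lC.
- by move=> l lL; rewrite dotp_reflect_out ?wl ?kerdock_line_norm.
- move=> l l' lL l'L ll'; rewrite dotp_reflect_out ?wl //.
  exact: kerdock_line_angle.
- by move: Cd; rewrite (cardsD1 (inl 0) C) CX.
Qed.

Lemma kerdock_lines_partial k d :
    (k <= #|F|)%N -> (#|{: X}| + k <= d.+1)%N ->
  (#|{: X}| * k <= max_equiangular R d)%N.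
Proof.
move=> kF le_d.
have [S /eqP Sk] : exists S : {set F}, #|S| == k.
  have := kF; rewrite -cardsT => /card_geqP[s [us ks _]].
  by exists [set x in s]; rewrite cardsE (card_uniqP us) ks.
pose L : {set line} := setX (Some @: S) setT.
have Some_inj : injective (@Some F) by move=> ? ? [].
have <- : #|L| = (#|{: X}| * k)%N.
  by rewrite cardsX card_imset // cardsT mulnC Sk.
pose C : {set coordinate} := (inl @: [set: X]) :|: ((inr \o Some) @: S).
apply: (@kerdock_lines_hyperplane S L C).
- by move=> [j a]; rewrite !inE andbT /= => /imsetP[s sS ->].
- by move=> x; rewrite inE imset_f.
- by move=> s sS; rewrite inE (imset_f (inr \o Some)) ?orbT.
- move=> [j a]; rewrite !inE andbT /= => /imsetP[s sS ->].
  by rewrite (imset_f (inr \o Some)) ?orbT.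
- apply: leq_trans le_d; apply: leq_trans (leq_card_setU _ _) _.
  by rewrite leq_add // -?Sk -?cardsT leq_imset_card.
Qed.

Lemma kerdock_lines_but_one d : (#|{: X}| + #|F|.+1 <= d.+1)%N ->
  (#|{: X}| * #|F|.+1 - 1 <= max_equiangular R d)%N.
Proof.
move=> le_d.
have <- : #|[set~ (None, 0) : line]| = (#|{: X}| * #|F|.+1 - 1)%N.
  by rewrite cardsC1 card_prod card_option mulnC subn1.
apply: (@kerdock_lines_hyperplane setT _ setT).
- by move=> [[s|] a]; rewrite !inE //= xpair_eqE.
- by move=> x; rewrite inE.
- by move=> s; rewrite !inE.
- by move=> l; rewrite !inE.
- by rewrite cardsT card_sum card_option.
Qed.

End KerdockLines.

(** * The bounds *)

Local Close Scope ring_scope.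
Local Open Scope nat_scope.

Lemma kerdock_field (i : nat) : 0 < i ->
  exists (F : finFieldType) (h : nat), [/\ 2%N \in [pchar F]%R,
    #|F| = 2 ^ h.*2.+1, #|{: F * 'I_2}| = 4 ^ i & #|F| = 4 ^ i %/ 2].
Proof.
case: i => // h _.
have [F F2 cardF] := @pPrimePowerField 2 h.*2.+1 isT isT.
have cardX : #|{: F * 'I_2}| = 4 ^ h.+1.
  by rewrite card_prod card_ord cardF -expnSr -(expnM 2 2); congr (2 ^ _); lia.
exists F, h; split => //.
by rewrite -cardX card_prod card_ord mulnK.
Qed.

Theorem corollary2p7 (R : realType) (d : nat) (hd : 25 <= d) :
  (exists2 i, 2 <= i & unique (fun j => in_window d (4 ^ j)) i) /\
  forall i m : nat, 2 <= i -> m = 4 ^ i -> in_window d m ->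
    [/\ 3 * m %/ 2 + 1 <= d <= 33 * m %/ 8 - 1 ->
          m * (m %/ 2 + 1) <= max_equiangular R d,
        33 * m %/ 8 <= d <= 6 * m - 1 ->
          4 * m * (d - 4 * m + 1) <= max_equiangular R d &
        d = 6 * m ->
          4 * m * (2 * m + 1) - 1 <= max_equiangular R d].
Proof.
split.
  (* As 3 * 4 ^ j.+1 / 2 = 6 * 4 ^ j, the window of j.+1 starts right after
     the end of the window of j. *)
  have exd : exists i, d <= 6 * 4 ^ i.
    by exists d; have := ltn_expl d (isT : 1 < 4); lia.
  have e4 j : 0 < j -> 4 ^ j = 4 * 4 ^ j.-1 by case: j => // j _; rewrite expnS.
  pose i := ex_minn exd.
  have [id imin] : d <= 6 * 4 ^ i /\ forall j, d <= 6 * 4 ^ j -> i <= j.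
    by rewrite /i; case: ex_minnP.
  have i2 : 2 <= i.
    rewrite leqNgt; apply/negP => i1; move: id hd.
    by case: (i) i1 => [|[|//]] _ /=; lia.
  exists i => //; split=> [|j].
    rewrite /in_window id andbT e4; last exact: ltnW.
    have /negP : ~~ (d <= 6 * 4 ^ i.-1).
      by apply/negP => /imin; rewrite -ltnS prednK ?ltnn // ltnW.
    lia.
  rewrite /in_window => /andP[jl /imin ij].
  apply/eqP; rewrite eqn_leq ij leqNgt; apply/negP => {ij} ij.
  have j0 : 0 < j by apply: leq_ltn_trans ij.
  have : 4 ^ i <= 4 ^ j.-1 by rewrite leq_exp2l // -ltnS prednK.
  by move: jl; rewrite (e4 j j0); lia.
move=> i m i2 mE md; have m_even : m = 2 * (m %/ 2).
  by rewrite mE -{1 2}(prednK (ltnW i2)) expnS; lia.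
have [F [h [F2 cardF cardX cardFm]]] := kerdock_field (ltnW i2).
have [F' [h' [F2' cardF' cardX' cardFm']]] := @kerdock_field i.+1 isT.
rewrite -mE in cardX cardFm; rewrite expnS -mE in cardX' cardFm'.
have {}cardFm' : #|F'| = 2 * m by rewrite cardFm'; lia.
split=> [/andP[d_ge _]|/andP[d_ge d_le]|dE].
- rewrite -cardFm -cardX addn1.
  by apply: (kerdock_lines_all R F2 cardF); lia.
- rewrite -cardX'.
  by apply: (kerdock_lines_partial R F2' cardF'); lia.
- rewrite -cardX' -cardFm' addn1.
  by apply: (kerdock_lines_but_one R F2' cardF'); lia.
Qed.
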